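(* Let $\beta\ge1$, $k'>0$, and let $x^1,\dots,x^T\in\mathbb{R}_{\ge0}^M$ be a fractional solution to the fully dynamic $k$-center problem, revealed online, such that for every $t$: $\sum_{i\in M} x_i^t\le k'$ and, for every client $j\in C^t$, $\sum_{i\in M:\, d_{ij}\le \min\{\beta\,\mathrm{OPT}^t,\Delta\}} x_i^t\ge 1$. Let $R=\sum_{t=1}^T\|x^t-x^{t-1}\|_1$ with $x^0=0$. Then for every $\epsilon\in(0,1/2]$ there is an online algorithm that maintains an integral solution $S^t\subseteq M$ with $|S^t|\le(1+2\epsilon)k'$ such that at every time $t$ every client $j\in C^t$ is within distance $\alpha\beta\,\mathrm{OPT}^t$ of some center in $S^t$ (i.e. the solution is $(\alpha\beta)$-approximate), where $\alpha=3+2\sqrt2$, and whose total recourse $\sum_t|S^t\oplus S^{t-1}|$ is $O(\log(\Delta)/\epsilon)\cdot R$.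
   Context: $(M,d)$ is a finite metric space with minimum nonzero distance $1$ and maximum distance $\Delta$ (the aspect ratio). At each time $t=1,\dots,T$ a set of clients $C^t\subseteq M$ is present. $\mathrm{OPT}^t$ denotes the optimal value of the fractional $k$-center problem at time $t$, i.e. the smallest $r$ such that there is $x\in\mathbb{R}^M_{\ge0}$ with $\sum_i x_i\le k$ and $\sum_{i:\,d_{ij}\le r}x_i\ge1$ for all $j\in C^t$. The integral algorithm may see $x^t$ and $\mathrm{OPT}^t$ at time $t$ only. *)

(* Defs.v *)
From mathcomp Require Import all_boot all_order all_algebra.
From mathcomp Require Import reals exp.

Set Implicit Arguments.
Unset Strict Implicit.
Unset Printing Implicit Defensive.

Import Order.TTheory GRing.Theory Num.Theory.
Local Open Scope ring_scope.

Section Defs.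
Variables (R : realType) (M : finType).
Implicit Types (d : M -> M -> R) (x : {ffun M -> R}) (C S : {set M}).

Definition is_metric d : Prop :=
  [/\ forall i j, 0 <= d i j,
      forall i j, d i j = 0 <-> i = j,
      forall i j, d i j = d j i &
      forall i j l, d i l <= d i j + d j l].

Definition min_nonzero_dist d (r : R) : Prop :=
  (exists i j, i != j /\ d i j = r) /\ (forall i j, i != j -> r <= d i j).

Definition max_dist d (r : R) : Prop :=
  (exists i j, d i j = r) /\ (forall i j, d i j <= r).

Definition nonneg_vec x : Prop := forall i, 0 <= x i.

Definition covers d C (r : R) x : Prop :=
  forall j, j \in C -> 1 <= \sum_(i | d i j <= r) x i.

Definition kcenter_feasible d (k : nat) C (r : R) : Prop :=
  exists x, [/\ nonneg_vec x, \sum_i x i <= k%:R & covers d C r x].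

(* r >= 0 is part of the minimisation: for C = set0 every real radius is
   feasible, and the optimal value is then 0. *)
Definition is_fractional_OPT d (k : nat) C (r : R) : Prop :=
  [/\ 0 <= r, kcenter_feasible d k C r &
      forall r', 0 <= r' -> kcenter_feasible d k C r' -> r <= r'].

Definition fractional_recourse (x : nat -> {ffun M -> R}) (T : nat) : R :=
  \sum_(1 <= t < T.+1) \sum_i `|x t i - x t.-1 i|.

(* A deterministic online algorithm maps the list of the pairs (x^s, OPT^s)
   revealed so far (s = 1, ..., t) to the solution S^t; it sees neither the
   client sets, nor future inputs, nor the horizon. *)
Definition online_algorithm : Type := seq ({ffun M -> R} * R) -> {set M}.

(* S^0 is empty, whatever the algorithm returns on the empty history. *)
Definition run (A : online_algorithm) (x : nat -> {ffun M -> R})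
    (OPT : nat -> R) (t : nat) : {set M} :=
  if t is 0 then set0 else A [seq (x s, OPT s) | s <- iota 1 t].

Definition symdiff S S' : {set M} := (S :\: S') :|: (S' :\: S).

Definition recourse (S : nat -> {set M}) (T : nat) : nat :=
  (\sum_(1 <= t < T.+1) #|symdiff (S t) (S t.-1)|)%N.

End Defs.

(* Main.v *)
(* The algorithm keeps pairwise disjoint balls B(s, R_s), one per center, and
   drops those of mass below 1 - eps. With r = min(beta * OPT, Delta) and
   g = 1 + sqrt 2, as long as some j has mass at least 1 in B(j, r) and no
   center within g^2 * r, the ball B(j, r) is inserted and every center v with
   d(v, j) <= R_v + g * r is evicted. Since each ball, when inserted, cleared a
   zone g times as wide as itself, an insertion evicts at most one ball, and
   the radius of that ball exceeds both 2 * r and 1/2. Hence there are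
   O(log Delta) evicting insertions per insertion without eviction, and the
   latter are paid for by the balls dropped, each of which lost mass at least
   eps, and by the final balls. *)
Require Import Defs.
From mathcomp Require Import all_boot all_order all_algebra.
From mathcomp Require Import reals exp.
From mathcomp Require Import lra.

Set Implicit Arguments.
Unset Strict Implicit.
Unset Printing Implicit Defensive.

Import Order.TTheory GRing.Theory Num.Theory.
Local Open Scope ring_scope.

Section SymmetricDifference.
Variable M : finType.
Implicit Types A B C : {set M}.

Lemma symdiffxx A : symdiff A A = set0.
Proof. by rewrite /symdiff setDv setU0. Qed.

Lemma card_symdiff_triangle A B C :
  (#|symdiff A C| <= #|symdiff A B| + #|symdiff B C|)%N.
Proof.
apply: leq_trans (leq_card_setU _ _); apply: subset_leq_card.
apply/subsetP => i; rewrite !inE.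
by case: (i \in A); case: (i \in B); case: (i \in C).
Qed.

End SymmetricDifference.

Lemma sqr_sqrt2 (R : rcfType) : Num.sqrt 2 * Num.sqrt 2 = 2 :> R.
Proof. by rewrite -expr2 sqr_sqrtr. Qed.

Lemma sqrt2_gt1 (R : rcfType) : 1 < Num.sqrt 2 :> R.
Proof. by rewrite -{1}[1]sqrtr1 ltr_sqrt ?ltr1n. Qed.

Lemma ln2_gt0 (R : realType) : 0 < ln 2 :> R.
Proof. by rewrite ln_gt0 ?ltr1n. Qed.

Lemma min_dist_le_max_dist (R : realType) (M : finType) (d : M -> M -> R) u v :
  min_nonzero_dist d u -> max_dist d v -> u <= v.
Proof. by move=> [[i [j [_ <-]]] _] [_ ->]. Qed.

(** * The rounding procedure, its invariants and its potential *)

Section Rounding.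
Variables (R : realType) (M : finType) (d : M -> M -> R) (Delta eps : R).
Implicit Types (x y : {ffun M -> R}) (r : R) (i j s : M).

Definition ball_mass x j r : R := \sum_(i | d i j <= r) x i.

(* The centers and their radii; the radius of a point that is not a center is
   meaningless. *)
Definition state : Type := ({set M} * {ffun M -> R})%type.
Implicit Types st : state.

Definition prune x st : state :=
  ([set s in st.1 | 1 - eps <= ball_mass x s (st.2 s)], st.2).

Definition uncovered x r st j : bool :=
  (1 <= ball_mass x j r) &&
  [forall s in st.1, (3 + 2 * Num.sqrt 2) * r < d s j].

Definition kept r st j : {set M} :=
  [set s in st.1 | st.2 s + (1 + Num.sqrt 2) * r < d s j].

Definition evicted r st j : {set M} := st.1 :\: kept r st j.

Definition insert r st j : state :=
  (j |: kept r st j, [ffun i => if i == j then r else st.2 i]).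

Definition improve x r st : state :=
  if [pick j | uncovered x r st j] is Some j then insert r st j else st.

Definition round x r st : state := iter #|M|.+1 (improve x r) (prune x st).

(* The disjunction records the order of insertion: the ball inserted last
   clears a zone wider by the factor 1 + sqrt 2 than itself. *)
Definition separated st : Prop :=
  forall a b, a \in st.1 -> b \in st.1 -> a != b ->
    st.2 a + (1 + Num.sqrt 2) * st.2 b < d a b \/
    st.2 b + (1 + Num.sqrt 2) * st.2 a < d a b.

Definition bounded st : Prop := forall s, s \in st.1 -> 0 <= st.2 s <= Delta.

Definition heavy x st : Prop :=
  forall s, s \in st.1 -> 1 - eps <= ball_mass x s (st.2 s).

(** The factor 14 makes [scale] at least twice every [radius_weight] of a radius up to [Delta]; the
    cut-off at 2 keeps this true when [Delta = 1]. *)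
Definition scale : R := 14 * ln (Num.max 2 Delta) / ln 2.

(* Evicted radii exceed 1/2, so cutting the logarithm off at 1/4 still lets the
   weight drop by 2 when a ball is replaced by one of half its radius. *)
Definition radius_weight r : R := 1 + 2 * ln (4 * Num.max r (1 / 4)) / ln 2.

(** The slope [scale / eps] makes a loss of mass [eps] cost the whole bonus [scale]: a ball of mass
    at least 1 is worth [scale - radius_weight r], one of mass below [1 - eps] less than -1. *)
Definition value x r s : R :=
  scale / eps * (Num.min 1 (ball_mass x s r) - 1) + scale - radius_weight r.

Definition potential x st : R := \sum_(s in st.1) value x (st.2 s) s.

Hypothesis d_metric : is_metric d.
Hypothesis d_min : min_nonzero_dist d 1.
Hypothesis eps_gt0 : 0 < eps.
Hypothesis eps_le_half : eps <= 1 / 2.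

Let dxx i : d i i = 0. Proof. by case: d_metric => _ H _ _; apply/H. Qed.
Let dC i j : d i j = d j i. Proof. by case: d_metric. Qed.
Let d_tri i j k : d i k <= d i j + d j k. Proof. by case: d_metric. Qed.
Let d_ge1 i j : i != j -> 1 <= d i j. Proof. by case: d_min => _; apply. Qed.

(** * Numerical bounds on the constants *)

Lemma scale_ge14 : 14 <= scale.
Proof.
rewrite /scale ler_pdivlMr ?ln2_gt0 // ler_pM2l //.
by rewrite ler_ln ?posrE ?lt_max ?ltr0n // le_max lexx.
Qed.

Lemma scale_eps_gt0 : 0 < scale / eps.
Proof. by apply: divr_gt0 => //; have := scale_ge14; lra. Qed.

Lemma radius_weight_ge1 r : 1 <= radius_weight r.
Proof.
rewrite /radius_weight lerDl divr_ge0 ?(ltW (ln2_gt0 R)) //.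
rewrite mulr_ge0 // ln_ge0 //.
have : 1 / 4 <= Num.max r (1 / 4) by rewrite le_max lexx orbT.
lra.
Qed.

Lemma radius_weight_le r : r <= Delta -> radius_weight r <= scale / 2.
Proof.
move=> r_le; set D := Num.max 2 Delta.
have D_ge2 : 2 <= D by rewrite le_max lexx.
have D_ge : Delta <= D by rewrite le_max lexx orbT.
have m_le : Num.max r (1 / 4) <= D by rewrite ge_max; apply/andP; split; lra.
have m_gt0 : 0 < Num.max r (1 / 4) by rewrite lt_max; apply/orP; right; lra.
have lnD : ln 2 <= ln D by rewrite ler_ln ?posrE //; lra.
(* [4 * D <= D ^ 3] because [D >= 2]. The leading 1 of the weight is absorbed below by
   [1 <= ln D / ln 2]. *)
have ln_le : ln (4 * Num.max r (1 / 4)) <= 3 * ln D.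
  have -> : 3 * ln D = ln (D * D * D) by rewrite !lnM ?posrE ?mulr_gt0 //; lra.
  rewrite ler_ln ?posrE ?mulr_gt0 //; try lra.
  nra.
have ln2 := ln2_gt0 R.
have u_gt0 : 0 < (ln 2)^-1 :> R by rewrite invr_gt0.
have : ln (4 * Num.max r (1 / 4)) * (ln 2)^-1 <= 3 * ln D * (ln 2)^-1.
  by rewrite ler_pM2r.
have : 1 <= ln D * (ln 2)^-1 by rewrite ler_pdivlMr // mul1r.
rewrite /radius_weight /scale -/D; lra.
Qed.

Lemma radius_weight_drop r r' :
  2 * r <= r' -> 1 / 2 <= r' -> radius_weight r + 2 <= radius_weight r'.
Proof.
move=> le_r ge_r'; have ln2 := ln2_gt0 R.
have r'E : Num.max r' (1 / 4) = r' :> R by apply/max_idPl; lra.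
have m_gt0 : 0 < Num.max r (1 / 4) by rewrite lt_max; apply/orP; right; lra.
have ln_le : ln (2 * (4 * Num.max r (1 / 4))) <= ln (4 * r').
  rewrite ler_ln ?posrE ?mulr_gt0 //; last lra.
  have : Num.max r (1 / 4) <= r' / 2 by rewrite ge_max; apply/andP; split; lra.
  lra.
rewrite [ln (2 * _)]lnM ?posrE ?mulr_gt0 // in ln_le.
have : ln 2 / ln 2 + ln (4 * Num.max r (1 / 4)) / ln 2 <= ln (4 * r') / ln 2.
  by rewrite -mulrDl ler_pM2r ?invr_gt0.
rewrite mulfV ?gt_eqF // /radius_weight r'E; lra.
Qed.

(** * Disjointness of the balls and its consequences *)

Lemma separated_disjoint st i a b : bounded st -> separated st ->
  a \in st.1 -> b \in st.1 -> d i a <= st.2 a -> d i b <= st.2 b -> a = b.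
Proof.
move=> bst sst aS bS ia ib; apply/eqP/negP => /negP ab.
have /andP[ra _] := bst _ aS; have /andP[rb _] := bst _ bS.
have tri := d_tri a i b; rewrite (dC a i) in tri.
have := sqrt2_gt1 R; set q := Num.sqrt 2 => q1.
(* Whichever ball came last, the separation exceeds the sum of the radii, against the triangle
   inequality through [i]. *)
case: (sst a b aS bS ab); rewrite -/q => lt_ab; nra.
Qed.

(** By disjointness each point is counted in at most one ball. *)
Lemma sum_ball_mass_le y st : bounded st -> separated st ->
  (forall i, 0 <= y i) ->
  \sum_(s in st.1) ball_mass y s (st.2 s) <= \sum_i y i.
Proof.
move=> bst sst y0; rewrite /ball_mass (exchange_big_dep predT) //=.
apply: ler_sum => i _.
case: (pickP (fun s => (s \in st.1) && (d i s <= st.2 s)))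
    => [s0 /andP[s0S is0]|none].
  rewrite (big_pred1 s0) // => s; apply/andP/eqP => [[sS si]|-> //].
  exact: (separated_disjoint bst sst sS s0S si is0).
by rewrite big_pred0.
Qed.

(** Controls a change of the input: truncation at 1 is 1-Lipschitz in the mass, and disjointness
    charges each coordinate to at most one ball. *)
Lemma potential_lipschitz x y st : bounded st -> separated st ->
  potential x st - potential y st <= scale / eps * \sum_i `|x i - y i|.
Proof.
move=> bst sst.
pose z : {ffun M -> R} := [ffun i => `|x i - y i|].
have z0 i : 0 <= z i by rewrite ffunE normr_ge0.
apply: (@le_trans _ _ (scale / eps * \sum_(s in st.1) ball_mass z s (st.2 s)));
    last first.
  rewrite ler_pM2l ?scale_eps_gt0 //.
  have -> : \sum_i `|x i - y i| = \sum_i z i.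
    by apply: eq_bigr => i _; rewrite ffunE.
  exact: sum_ball_mass_le.
rewrite /potential -sumrB mulr_sumr; apply: ler_sum => s sS.
have : ball_mass x s (st.2 s) - ball_mass y s (st.2 s)
    <= ball_mass z s (st.2 s).
  rewrite /ball_mass -sumrB; apply: ler_sum => i _.
  by rewrite ffunE ler_norm.
have : 0 <= ball_mass z s (st.2 s) by apply: sumr_ge0 => i _; exact: z0.
rewrite /value; move: (ball_mass x _ _) (ball_mass y _ _) (ball_mass z _ _).
move=> mx my mz mz0 m_le.
have : Num.min 1 mx - Num.min 1 my <= mz.
  by rewrite !minEle; case: ifP => /=; case: ifP => /=; lra.
move=> /(ler_wpM2l (ltW scale_eps_gt0)); lra.
Qed.

Lemma potential_le x st : bounded st -> separated st -> nonneg_vec x ->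
  potential x st <= scale / eps * \sum_i x i.
Proof.
move=> bst sst x0; have S14 := scale_ge14.
have S_gt0 : 0 < scale by lra.
apply: (@le_trans _ _ (scale / eps * \sum_(s in st.1) ball_mass x s (st.2 s)));
    last by rewrite ler_pM2l ?scale_eps_gt0 //; exact: sum_ball_mass_le.
rewrite mulr_sumr; apply: ler_sum => s sS; rewrite /value.
have := radius_weight_ge1 (st.2 s).
have : Num.min 1 (ball_mass x s (st.2 s)) <= ball_mass x s (st.2 s).
  by rewrite ge_min lexx orbT.
move=> /(ler_wpM2l (ltW scale_eps_gt0)).
have : scale <= scale / eps.
  rewrite ler_pdivlMr //; move: S_gt0 eps_gt0 eps_le_half; move: scale => z.
  nra.
lra.
Qed.

Lemma card_heavy x st (k' : R) : bounded st -> separated st -> heavy x st ->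
  nonneg_vec x -> \sum_i x i <= k' -> (#|st.1|)%:R <= (1 + 2 * eps) * k'.
Proof.
move=> bst sst hst x0 x_le.
have : (1 - eps) * (#|st.1|)%:R <= k'.
  apply: le_trans x_le; apply: le_trans (sum_ball_mass_le bst sst x0).
  by rewrite mulr_natr -sumr_const; apply: ler_sum => s /hst.
have : 0 <= (#|st.1|)%:R :> R by [].
move: (#|st.1|)%:R => n n0 n_le.
have : (1 + 2 * eps) * ((1 - eps) * n) <= (1 + 2 * eps) * k'.
  by apply: ler_wpM2l => //; move: eps_gt0; lra.
(* [(1 + 2 * eps) * (1 - eps) = 1 + eps * (1 - 2 * eps)], which is at least 1 for [eps <= 1 / 2]. *)
have : 0 <= eps * (1 - 2 * eps) * n.
  by rewrite !mulr_ge0 //; move: eps_gt0 eps_le_half; lra.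
lra.
Qed.

(** * Dropping light balls *)

Lemma prune_inv x st : bounded st -> separated st ->
  [/\ bounded (prune x st), separated (prune x st) & heavy x (prune x st)].
Proof.
move=> bst sst; split.
- by move=> s; rewrite inE => /andP[/bst].
- by move=> a b; rewrite !inE => /andP[aS _] /andP[bS _]; apply: sst.
- by move=> s; rewrite inE => /andP[].
Qed.

(** A dropped ball had value at most -1, so its removal raises the potential by at least the unit of
    recourse it costs. *)
Lemma prune_cost x st : bounded st ->
  (#|symdiff (prune x st).1 st.1|)%:R
    <= potential x (prune x st) - potential x st.
Proof.
move=> bst; set A := (prune x st).1.
have sA : A \subset st.1 by apply/subsetP => s; rewrite inE => /andP[].
have -> : symdiff A st.1 = st.1 :\: A.
  by move: sA; rewrite -setD_eq0 /symdiff => /eqP ->; rewrite set0U.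
rewrite {2}/potential (big_setID A) /= (setIidPr sA) opprD addrA.
rewrite [X in _ <= X - _](_ : _ = 0) ?sub0r; last exact: subrr.
rewrite -sum1_card natr_sum -sumrN; apply: ler_sum => s.
rewrite !inE => /andP[+ sS]; rewrite sS /= -ltNge /value => m_lt.
have := radius_weight_ge1 (st.2 s).
have : Num.min 1 (ball_mass x s (st.2 s)) - 1 <= - eps.
  have : Num.min 1 (ball_mass x s (st.2 s)) <= ball_mass x s (st.2 s).
    by rewrite ge_min lexx orbT.
  lra.
move=> /(ler_wpM2l (ltW scale_eps_gt0)); rewrite mulrN mulfVK ?gt_eqF //; lra.
Qed.

(** * A single insertion *)

Section Insertion.
Variables (x : {ffun M -> R}) (r : R) (st : state) (j : M).
Hypothesis r_bounds : 0 <= r <= Delta.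
Hypothesis bst : bounded st.
Hypothesis sst : separated st.
Hypothesis j_uncovered : uncovered x r st j.

Lemma uncovered_far s : s \in st.1 -> (3 + 2 * Num.sqrt 2) * r < d s j.
Proof. by move: j_uncovered => /andP[_ /forall_inP]; apply. Qed.

Lemma uncovered_notin : j \notin st.1.
Proof.
apply/negP => /uncovered_far; rewrite dxx; have := sqrt2_gt1 R.
by move: r_bounds => /andP[]; nra.
Qed.

(** Comparing the upper bound on [d v j] with [(3 + 2 * sqrt 2) * r < d v j] leaves a radius above
    [(2 + sqrt 2) * r]. Hence [1 <= d v j] is at most twice the radius, which gives the bound
    1/2. *)
Lemma evictedP v : v \in evicted r st j ->
  [/\ v \in st.1, d v j <= st.2 v + (1 + Num.sqrt 2) * r,
      (2 + Num.sqrt 2) * r < st.2 v & 1 / 2 <= st.2 v].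
Proof.
rewrite !inE => /andP[+ vS]; rewrite vS /= -leNgt => near.
have far := uncovered_far vS.
have q1 := sqrt2_gt1 R; have qq := sqr_sqrt2 R.
have /andP[r0 _] := r_bounds.
have vj : v != j by apply: contraNneq uncovered_notin => <-.
have d1 := d_ge1 vj.
have big : (2 + Num.sqrt 2) * r < st.2 v by lra.
by split => //; nra.
Qed.

(* The only place where 3 + 2 * sqrt 2 matters: with g = 1 + sqrt 2, two
   evicted balls would force g * (g - 1)^2 * r < 2 * g * r. *)
Lemma card_evicted_le1 : (#|evicted r st j| <= 1)%N.
Proof.
apply/card_le1_eqP => a b /evictedP[aS aj ra _] /evictedP[bS bj rb _].
apply/eqP/negP => /negP; rewrite eq_sym => ab.
have tri := d_tri a j b; rewrite (dC j b) in tri.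
have q1 := sqrt2_gt1 R; have qq := sqr_sqrt2 R.
have /andP[r0 _] := r_bounds.
move: (sst aS bS ab) aj bj ra rb; set q := Num.sqrt 2 in q1 qq *.
move: (st.2 a) (st.2 b) => ua ub lt_ab aj bj ra rb.
have qr : q * (q * r) = 2 * r by rewrite mulrA qq.
case: lt_ab => lt_ab.
  have : q * ((2 + q) * r) <= q * ub by rewrite ler_pM2l; lra.
  lra.
have : q * ((2 + q) * r) <= q * ua by rewrite ler_pM2l; lra.
lra.
Qed.

Lemma insert_bounded : bounded (insert r st j).
Proof.
move=> s; rewrite !inE ffunE; case: eqP => //= _ /andP[sS _]; exact: bst.
Qed.

(** The condition defining [kept] is the separation inequality with the new ball as the later
    one. *)
Lemma insert_separated : separated (insert r st j).
Proof.
move=> a b; rewrite !inE !ffunE.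
case: (eqVneq a j) => [->|aj]; case: (eqVneq b j) => [->|bj] //=.
- by move=> _ /andP[bS jb] _; right; rewrite dC.
- by move=> /andP[aS ja] _ _; left.
- by move=> /andP[aS _] /andP[bS _]; apply: sst.
Qed.

Lemma insert_heavy : heavy x st -> heavy x (insert r st j).
Proof.
move=> hst s; rewrite !inE ffunE; case: eqP => [-> _|_ /andP[sS _]] //=.
  by case/andP: j_uncovered => m1 _; have := eps_gt0; lra.
exact: hst.
Qed.

Lemma kept_subset : kept r st j \subset st.1.
Proof. by apply/subsetP => s; rewrite inE => /andP[]. Qed.

Lemma symdiff_insert :
  symdiff (insert r st j).1 st.1 = j |: evicted r st j.
Proof.
apply/setP => s; rewrite !inE.
have := uncovered_notin; case: (eqVneq s j) => [->|] /=.
  by case: (j \in st.1).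
by case: (s \in st.1); case: (_ < _).
Qed.

Lemma value_bounds s u : 0 <= u <= Delta ->
  value x u s <= scale - radius_weight u /\ 7 <= scale - radius_weight u.
Proof.
move=> /andP[u0 uD]; have S14 := scale_ge14; split; last first.
  by have := radius_weight_le uD; lra.
rewrite /value.
have : Num.min 1 (ball_mass x s u) - 1 <= 0 by rewrite subr_le0 ge_min lexx.
move=> /(ler_wpM2l (ltW scale_eps_gt0)); rewrite mulr0; lra.
Qed.

(** Without eviction, the new ball adds at least 7 for a recourse of 1. With one eviction, the
    [scale] terms cancel and the drop of at least 2 in [radius_weight] pays for the recourse of
    2. *)
Lemma insert_cost :
  (#|symdiff (insert r st j).1 st.1|)%:R
    <= potential x (insert r st j) - potential x st.
Proof.
have jK : j \notin kept r st j.
  by apply: contra uncovered_notin; apply/subsetP/kept_subset.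
have -> : potential x (insert r st j) =
    scale - radius_weight r + \sum_(s in kept r st j) value x (st.2 s) s.
  rewrite /potential big_setU1 //= ffunE eqxx; congr (_ + _).
    rewrite /value; case/andP: j_uncovered => /min_idPl -> _.
    by rewrite subrr mulr0 add0r.
  apply: eq_bigr => s sK; rewrite ffunE; case: eqP => // sj.
  by rewrite sj (negPf jK) in sK.
rewrite symdiff_insert cardsU1.
have -> : j \notin evicted r st j.
  by rewrite !inE (negPf uncovered_notin) andbF.
have -> : potential x st = \sum_(s in kept r st j) value x (st.2 s) s +
    \sum_(s in evicted r st j) value x (st.2 s) s.
  by rewrite /potential (big_setID (kept r st j)) /= (setIidPr kept_subset).
have [_ r7] := value_bounds j r_bounds.
case: (posnP #|evicted r st j|) => [/eqP|].
  by rewrite cards_eq0 => /eqP ->; rewrite cards0 big_set0 /= addn0; lra.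
move=> ev_gt0; have /cards1P[v ev] : #|evicted r st j| == 1%N.
  by rewrite eqn_leq card_evicted_le1.
have /evictedP[vS _ rv v_half] : v \in evicted r st j by rewrite ev set11.
rewrite ev cards1 big_set1 /= addn1.
have [val_le _] := value_bounds v (bst vS).
have drop : radius_weight r + 2 <= radius_weight (st.2 v).
  apply: radius_weight_drop => //; have := sqrt2_gt1 R.
  by move: r_bounds => /andP[]; nra.
lra.
Qed.

(** Progress measure within a round: evicted radii exceed [(2 + sqrt 2) * r], so no ball of radius
    [r] is lost while one is gained. *)
Lemma card_new_radius :
  (#|[set s in st.1 | st.2 s == r]|
     < #|[set s in (insert r st j).1 | (insert r st j).2 s == r]|)%N.
Proof.
set T := [set s in st.1 | _].
have jT : j \notin T by rewrite !inE (negPf uncovered_notin).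
have -> : #|T|.+1 = #|j |: T| by rewrite cardsU1 jT.
apply: subset_leq_card; apply/subsetP => s; rewrite !inE ffunE.
case: (eqVneq s j) => [_|sj] /=; first by rewrite eqxx.
move=> /andP[sS /eqP sr]; rewrite sS sr eqxx andbT /=.
have : s \notin evicted r st j.
  apply/negP => /evictedP[_ _ + _]; rewrite sr; have := sqrt2_gt1 R.
  by move: r_bounds => /andP[]; nra.
by rewrite !inE sS andbT negbK sr.
Qed.

End Insertion.

(** * A complete round *)

Section Round.
Variables (x : {ffun M -> R}) (r : R).
Hypothesis r_bounds : 0 <= r <= Delta.

Definition invariant st : Prop :=
  [/\ bounded st, separated st & heavy x st].

Lemma improve_spec st : invariant st ->
  invariant (improve x r st) /\
  (#|symdiff (improve x r st).1 st.1|)%:R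
    <= potential x (improve x r st) - potential x st.
Proof.
move=> [bst sst hst]; rewrite /improve; case: pickP => [j unc|_].
  split; last exact: insert_cost.
  split; first exact: insert_bounded.
    exact: insert_separated.
  exact: insert_heavy.
by split; rewrite ?symdiffxx ?cards0 ?subrr.
Qed.

Lemma iter_improve_spec n st : invariant st ->
  invariant (iter n (improve x r) st) /\
  (#|symdiff (iter n (improve x r) st).1 st.1|)%:R
    <= potential x (iter n (improve x r) st) - potential x st.
Proof.
move=> ist; elim: n => [|n [IHi IHc]] /=.
  by split; rewrite ?symdiffxx ?cards0 ?subrr.
have [ii cc] := improve_spec IHi; split=> //.
have tri := card_symdiff_triangle (improve x r (iter n (improve x r) st)).1
  (iter n (improve x r) st).1 st.1.
rewrite -(ler_nat R) natrD in tri; lra.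
Qed.

(* Within a round every inserted ball has radius r, and balls of radius r are
   never evicted, so their number, at most #|M|, bounds the number of insertions. *)
Lemma iter_improve_stable st j :
  ~~ uncovered x r (iter #|M|.+1 (improve x r) st) j.
Proof.
(* An idle step would leave the state fixed with nothing uncovered, so a point uncovered after [n]
   steps means that all of them inserted a ball. *)
suff count n j' : uncovered x r (iter n (improve x r) st) j' ->
    (n <= #|[set s in (iter n (improve x r) st).1 |
             (iter n (improve x r) st).2 s == r]|)%N.
  by apply/negP => /count; rewrite leqNgt ltnS max_card.
elim: n j' => [//|n IHn] j' /=; set st' := iter n _ st; rewrite /improve.
case: pickP => [j0 unc _|none]; last by rewrite none.
exact: leq_ltn_trans (IHn _ unc) (card_new_radius r_bounds unc).
Qed.

Lemma round_spec st : bounded st -> separated st ->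
  [/\ invariant (round x r st),
      (#|symdiff (round x r st).1 st.1|)%:R
        <= potential x (round x r st) - potential x st &
      forall j, 1 <= ball_mass x j r ->
        exists2 s, s \in (round x r st).1 &
          d s j <= (3 + 2 * Num.sqrt 2) * r].
Proof.
move=> bst sst; have ist : invariant (prune x st) by exact: prune_inv.
have [ii cc] := iter_improve_spec #|M|.+1 ist; split=> //.
  have pc := prune_cost x bst.
  have := card_symdiff_triangle (round x r st).1 (prune x st).1 st.1.
  by rewrite -(ler_nat R) natrD; move: cc; rewrite -/(round x r st); lra.
move=> j mj; have := iter_improve_stable (prune x st) j.
rewrite /uncovered mj negb_forall => /existsP[s].
by rewrite negb_imply -leNgt => /andP[]; exists s.
Qed.

End Round.



End Rounding.

(** * The online algorithm and the final accounting *)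

Section Algorithm.
Variables (R : realType) (M : finType) (d : M -> M -> R) (Delta eps beta : R).

(** The state is recomputed from the whole history because the output sets do not record the
    radii. *)
Definition play (h : seq ({ffun M -> R} * R)) : state R M :=
  foldl (fun st p => round d eps p.1 (Num.min (beta * p.2) Delta) st)
        (set0, [ffun=> 0]) h.

Definition rounding : online_algorithm R M := fun h => (play h).1.

Lemma play_rcons h x o : play (rcons h (x, o)) =
  round d eps x (Num.min (beta * o) Delta) (play h).
Proof. by rewrite /play foldl_rcons. Qed.

Lemma run_rounding x OPT t :
  run rounding x OPT t = (play [seq (x s, OPT s) | s <- iota 1 t]).1.
Proof. by case: t. Qed.

End Algorithm.

Section FractionalRecourse.
Variables (R : realType) (M : finType) (x : nat -> {ffun M -> R}).

Lemma fractional_recourseS t : fractional_recourse x t.+1 =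
  fractional_recourse x t + \sum_i `|x t.+1 i - x t i|.
Proof. by rewrite /fractional_recourse big_nat_recr. Qed.

(** Starting from 0, mass appears only through changes of [x]; this lets the fractional recourse pay
    for the final potential. *)
Lemma mass_le_fractional_recourse t : (forall i, x 0%N i = 0) ->
  \sum_i x t i <= fractional_recourse x t.
Proof.
move=> x0; elim: t => [|t IHt].
  by rewrite /fractional_recourse big_geq // big1.
rewrite fractional_recourseS; apply: le_trans (lerD IHt (lexx _)).
rewrite -big_split; apply: ler_sum => i _ /=.
by rewrite -lerBlDl ler_norm.
Qed.

End FractionalRecourse.

Theorem theorem3 (R : realType) :
  exists c : R, 0 < c /\
  forall (M : finType) (d : M -> M -> R) (Delta : R),
    is_metric d -> min_nonzero_dist d 1 -> max_dist d Delta ->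
  forall (k : nat) (beta k' eps : R),
    1 <= beta -> 0 < k' -> 0 < eps -> eps <= 1 / 2 ->
  exists A : online_algorithm R M,
  forall (T : nat) (C : nat -> {set M}) (OPT : nat -> R)
         (x : nat -> {ffun M -> R}),
    (forall t, (1 <= t <= T)%N -> is_fractional_OPT d k (C t) (OPT t)) ->
    (forall i, x 0%N i = 0) ->
    (forall t, (1 <= t <= T)%N ->
       [/\ nonneg_vec (x t),
           \sum_i x t i <= k' &
           covers d (C t) (Num.min (beta * OPT t) Delta) (x t)]) ->
    let S := run A x OPT in
    let alpha : R := 3 + 2 * Num.sqrt 2 in
    [/\ forall t, (1 <= t <= T)%N -> (#|S t|)%:R <= (1 + 2 * eps) * k',
        forall t, (1 <= t <= T)%N -> forall j, j \in C t ->
          exists2 i, i \in S t & d i j <= alpha * beta * OPT t &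
        (recourse S T)%:R
          <= c * (ln (Num.max 2 Delta) / eps) * fractional_recourse x T].
Proof.
(* [28 = 2 * 14]: [scale / eps] times the fractional recourse is paid once for the changes of [x]
   and once for the final potential. *)
exists (28 / ln 2); split; first by rewrite divr_gt0 ?ln2_gt0.
move=> M d Delta dm dmin dmax k beta k' eps beta1 k'0 eps0 eps2.
exists (rounding d Delta eps beta) => T C OPT x optP x0 xP S alpha.
pose st t := play d Delta eps beta [seq (x s, OPT s) | s <- iota 1 t].
pose r t := Num.min (beta * OPT t) Delta.
have SE t : S t = (st t).1 by exact: run_rounding.
have stS t : st t.+1 = round d eps (x t.+1) (r t.+1) (st t).
  by rewrite /st -[t.+1]addn1 iotaD map_cat cats1 play_rcons add1n addn1.
have D1 := min_dist_le_max_dist dmin dmax.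
have r_bounds t : (t < T)%N -> 0 <= r t.+1 <= Delta.
  move=> /(optP t.+1)[opt0 _ _]; rewrite ge_min lexx orbT andbT le_min.
  by rewrite mulr_ge0 //=; lra.
have inv t : (t <= T)%N -> bounded Delta (st t) /\ separated d (st t).
  elim: t => [_|t IHt tT]; first by split=> [s|a b]; rewrite in_set0.
  have [b s] := IHt (ltnW tT).
  by have [[]] := round_spec dm dmin eps0 (x t.+1) (r_bounds _ tT) b s;
    rewrite -stS.
have step t : (t < T)%N ->
    [/\ invariant d Delta eps (x t.+1) (st t.+1),
      (#|symdiff (st t.+1).1 (st t).1|)%:R
        <= potential d Delta eps (x t.+1) (st t.+1)
           - potential d Delta eps (x t.+1) (st t) &
      forall j, 1 <= ball_mass d (x t.+1) j (r t.+1) ->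
        exists2 s, s \in (st t.+1).1 & d s j <= alpha * r t.+1].
  move=> tT; have [b s] := inv t (ltnW tT); rewrite stS.
  exact: (round_spec dm dmin eps0 (x t.+1) (r_bounds _ tT) b s).
split.
- move=> [//|t] tT; have [x_ge0 x_le _] := xP _ tT.
  rewrite SE; have [[b s h] _ _] := step t tT.
  exact: (card_heavy dm eps0 eps2 b s h x_ge0 x_le).
- move=> [//|t] tT j jC; have [_ _ /(_ j jC) mj] := xP _ tT.
  have [_ _ /(_ j mj)[i iS dij]] := step t tT; exists i; rewrite ?SE //.
  apply: le_trans dij _; rewrite -mulrA ler_wpM2l ?ge_min ?lexx //.
  by rewrite /alpha; have := sqrt2_gt1 R; lra.
(* Amortisation: the recourse of a round is at most the gain in potential under the new [x], and
   passing from the old [x] to the new one loses at most the Lipschitz bound. *)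
have rec t : (t <= T)%N -> (recourse S t)%:R <=
    potential d Delta eps (x t) (st t)
    + scale Delta / eps * fractional_recourse x t.
  elim: t => [_|t IHt tT].
    rewrite /recourse /fractional_recourse !big_geq // mulr0 addr0.
    by rewrite /potential big_set0.
  rewrite /recourse big_nat_recr //= natrD -/(recourse S t) !SE.
  have [b s] := inv t (ltnW tT); have [_ cost _] := step t tT.
  have := potential_lipschitz dm eps0 (x t) (x t.+1) b s.
  under eq_bigr do rewrite distrC.
  rewrite fractional_recourseS mulrDr.
  by have := IHt (ltnW tT); lra.
have [b s] := inv T (leqnn T).
have xT : nonneg_vec (x T).
  (* Feasibility is given from time 1 on only; for [T = 0] the vector is zero. *)
  case: (posnP T) => [-> i|T0]; first by rewrite x0.
  by case: (xP T); rewrite ?T0 ?leqnn.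
have : potential d Delta eps (x T) (st T) <=
    scale Delta / eps * fractional_recourse x T.
  apply: le_trans (potential_le dm eps0 eps2 b s xT) _.
  rewrite ler_wpM2l ?mass_le_fractional_recourse // ltW //.
  exact: scale_eps_gt0.
have -> : 28 / ln 2 * (ln (Num.max 2 Delta) / eps) * fractional_recourse x T =
    2 * (scale Delta / eps * fractional_recourse x T).
  by rewrite /scale; lra.
by have := rec T (leqnn T); lra.
Qed.
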